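(* Let $P$ be an MCPM and let $A$ be a type $\mathrm{A}_P$ magic square with magic number $\mu$. If $\lambda\neq\mu$ is an eigenvalue of $A$ with associated eigenvector $x$, then $-\lambda$ is also an eigenvalue of $A$, with associated eigenvector $Px$.
   Context: Let $e_1,\dots,e_n$ be the standard basis column vectors of $\mathbb{R}^n$, $e\in\mathbb{R}^n$ the all-ones column vector, $E=ee^T$ the all-ones $n\times n$ matrix, and $J$ the $n\times n$ reverse matrix, with $J_{i,j}=1$ if $i+j=n+1$ and $J_{i,j}=0$ otherwise. A magic square of order $n$ with magic number $\mu$ is a real $n\times n$ matrix $A$ with $e_i^TAe=\mu$ for all $i$, $e^TAe_j=\mu$ for all $j$, $\operatorname{tr}(A)=\mu$ and $\operatorname{tr}(JA)=\mu$. A magic classifying permutation matrix (MCPM) of order $n$ is a symmetric $n\times n$ permutation matrix $P$ such that: if $n$ is even then $\operatorname{tr}(P)=0$; if $n$ is odd then the middle (center) entry of $P$ is $1$ and $\operatorname{tr}(P)=1$. A magic square $A$ of order $n$ with magic number $\mu$ is of type $\mathrm{A}_P$, where $P$ is an MCPM of order $n$, if $A+PAP=\frac{2\mu}{n}E$. Eigenvalues and eigenvectors may be complex. *)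

(* Defs.v *)
From HB Require Import structures.
From mathcomp Require Import all_boot all_order all_algebra.
From mathcomp Require Import reals.
From mathcomp Require Import complex.

Set Implicit Arguments.
Unset Strict Implicit.
Unset Printing Implicit Defensive.

Import GRing.Theory.
Local Open Scope ring_scope.

Section MagicSquares.
Variables (R : realType) (n : nat).

Definition unit_cv (i : 'I_n) : 'cV[R]_n := delta_mx i 0.

Definition ones_cv : 'cV[R]_n := const_mx 1.

Definition ones_mx : 'M[R]_n := ones_cv *m ones_cv^T.

(* Indices start at 0, so the condition i + j = n + 1 on indices starting at 1
   reads i.+1 + j.+1 = n.+1. *)
Definition reverse_mx : 'M[R]_n :=
  \matrix_(i, j) (if (i.+1 + j.+1 == n.+1)%N then 1 else 0).

(* [0 0] extracts the entry of a 1 x 1 matrix. *)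
Definition magic_square (mu : R) (A : 'M[R]_n) : Prop :=
  [/\ forall i : 'I_n, ((unit_cv i)^T *m A *m ones_cv) 0 0 = mu,
      forall j : 'I_n, (ones_cv^T *m A *m unit_cv j) 0 0 = mu,
      \tr A = mu
    & \tr (reverse_mx *m A) = mu].

(* For odd n the (0-based) index n./2 is the middle one. *)
Definition mcpm (P : 'M[R]_n) : Prop :=
  [/\ is_perm_mx P,
      P^T = P,
      ~~ odd n -> \tr P = 0
    & odd n ->
        (forall c : 'I_n, c = n./2 :> nat -> P c c = 1) /\ \tr P = 1].

Definition magic_type_A (P : 'M[R]_n) (mu : R) (A : 'M[R]_n) : Prop :=
  magic_square mu A /\ A + P *m A *m P = (2 * mu / n%:R) *: ones_mx.

Definition complex_mx (A : 'M[R]_n) : 'M[R[i]]_n := map_mx (real_complex R) A.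

(* Column (right) eigenvectors: the library's [eigenvalue] and [eigenspace]
   are about row vectors acting on the left. *)
Definition eigenpair (A : 'M[R]_n) (a : R[i]) (x : 'cV[R[i]]_n) : Prop :=
  x != 0 /\ complex_mx A *m x = a *: x.

End MagicSquares.

(* Main.v *)
Require Import Defs.
From HB Require Import structures.
From mathcomp Require Import all_boot all_order all_fingroup all_algebra.
From mathcomp Require Import reals.
From mathcomp Require Import complex.

(** Since the column sums of [A] are all [mu], the row vector [e^T] is a left
    eigenvector of [A] for [mu].  A right eigenvector [x] for any other
    eigenvalue is therefore orthogonal to it ([left_right_eigen_orthogonal]),
    so that [E x = e (e^T x) = 0].  Applied to [x], the identity
    [A + P A P = (2 mu / n) E] then reads [P A P x = - lambda x].  As [P] is a
    symmetric permutation matrix it is an involution ([sym_perm_mx_invol]), and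
    multiplying by [P] gives [A (P x) = - lambda (P x)], with [P x] nonzero. *)

Set Implicit Arguments.
Unset Strict Implicit.
Unset Printing Implicit Defensive.

Import GRing.Theory.
Local Open Scope ring_scope.

(** The inverse of a permutation matrix is its transpose. *)
Lemma sym_perm_mx_invol (R : comNzRingType) (n : nat) (P : 'M[R]_n) :
  is_perm_mx P -> P^T = P -> P *m P = 1%:M.
Proof.
case/is_perm_mxP=> s -> Psym.
by rewrite -{2}Psym tr_perm_mx -perm_mxM mulgV perm_mx1.
Qed.

(** Computing [v A x] in two ways gives [mu (v x) = lambda (v x)]. *)
Lemma left_right_eigen_orthogonal (F : fieldType) (n : nat) (A : 'M[F]_n)
    (mu lambda : F) (v : 'rV[F]_n) (x : 'cV[F]_n) :
  v *m A = mu *: v -> A *m x = lambda *: x -> lambda != mu -> v *m x = 0.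
Proof.
move=> vA Ax neq; apply/eqP.
have : (lambda - mu) *: (v *m x) == 0.
  by rewrite scalerBl scalemxAr -Ax mulmxA vA scalemxAl subrr.
by rewrite scaler_eq0 subr_eq0 (negPf neq).
Qed.

Lemma magic_ones_left_eigen (R : realType) (n : nat) (mu : R) (A : 'M[R]_n) :
  magic_square mu A -> (ones_cv R n)^T *m A = mu *: (ones_cv R n)^T.
Proof.
case=> _ colsum _ _; apply/rowP=> j.
by move: (colsum j); rewrite /unit_cv -colE !mxE mulr1.
Qed.

Theorem theorem10 (R : realType) (n : nat) (P A : 'M[R]_n) (mu : R)
    (hP : mcpm P) (hA : magic_type_A P mu A)
    (lambda : R[i]) (x : 'cV[R[i]]_n)
    (hlambda : lambda <> real_complex R mu) (hx : eigenpair A lambda x) :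
  eigenpair A (- lambda) (complex_mx P *m x).
Proof.
case: hP hA hx => Pperm Psym _ _ [magicA typeA] [x_neq0 Ax].
have PP : complex_mx P *m complex_mx P = 1%:M.
  by rewrite -map_mxM sym_perm_mx_invol // map_mx1.
have ex0 : complex_mx (ones_mx R n) *m x = 0.
  rewrite /complex_mx map_mxM -mulmxA.
  have eA : map_mx (real_complex R) (ones_cv R n)^T *m complex_mx A
      = real_complex R mu *: map_mx (real_complex R) (ones_cv R n)^T.
    by rewrite -map_mxM (magic_ones_left_eigen magicA) map_mxZ.
  rewrite (left_right_eigen_orthogonal eA Ax) ?mulmx0 //; exact/eqP.
have PAPx : complex_mx P *m complex_mx A *m complex_mx P *m x = - lambda *: x.
  have : complex_mx (A + P *m A *m P) *m x = 0.
    by rewrite typeA /complex_mx map_mxZ -scalemxAl ex0 scaler0.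
  rewrite /complex_mx map_mxD !map_mxM mulmxDl Ax => /eqP.
  by rewrite addrC addr_eq0 scaleNr => /eqP.
split.
  apply: contraNneq x_neq0 => Px0.
  by rewrite -[x]mul1mx -PP -mulmxA Px0 mulmx0.
by rewrite scalemxAr -PAPx !mulmxA PP mul1mx.
Qed.
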